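(* Fix $\delta\in(0,1/18)$ and let $\eta=1/4-\delta$. There exist constants $C_0,c_0>0$ depending only on $\delta$ such that for every dimension $d\ge1$ and every step size $h\in[d^{-\frac12+3\delta},\,d^{-\frac13}]$, the conductance $\mathsf C$ of the MALA chain with target distribution $\pi_\eta$ on $\mathbb R^d$ and step size $h$ satisfies $$\mathsf C\le C_0\exp\bigl(-c_0\,d^{4\delta}\bigr).$$
   Context: For $\eta\in(0,1/4)$, $\pi_\eta$ is the probability measure on $\mathbb R^d$ with density $\propto\exp(-V_\eta)$, where $V_\eta(x)=\frac{\|x\|^2}{2}-\frac{1}{2d^{2\eta}}\sum_{i=1}^d\cos(d^\eta x_i)$. MALA with target $\pi\propto\exp(-V)$ and step size $h>0$: the proposal kernel $Q(x,\cdot)$ is the Gaussian $\mathcal N(x-h\nabla V(x),2hI_d)$ with density $Q(x,y)$; acceptance probability $A(x,y)=\min\bigl\{1,\frac{\pi(y)Q(y,x)}{\pi(x)Q(x,y)}\bigr\}$; the MALA kernel is $T(x,B)=\int_BQ(x,y)A(x,y)\,dy+\mathbf 1_B(x)\bigl(1-\int_{\mathbb R^d}Q(x,y)A(x,y)\,dy\bigr)$. The conductance is $\mathsf C=\inf\bigl\{\frac{\int_ST(x,S^{c})\,\pi(dx)}{\pi(S)}: S\subseteq\mathbb R^d\text{ measurable},\ 0<\pi(S)\le\frac12\bigr\}$. *)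

(* Defs.v *)
From HB Require Import structures.
From mathcomp Require Import all_boot all_order all_algebra.
From mathcomp Require Import all_classical all_reals all_analysis.
From mathcomp Require Import measurable_realfun.

Set Implicit Arguments.
Unset Strict Implicit.
Unset Printing Implicit Defensive.

Import Order.TTheory GRing.Theory Num.Theory.
Import numFieldNormedType.Exports.

Local Open Scope classical_set_scope.
Local Open Scope ring_scope.

(* R^d is ['rV[R]_d], with the product sigma-algebra generated by the
   coordinates (over R, this is the Borel sigma-algebra of R^d). *)
Definition measure_rV_display : measure_display -> measure_display.
Proof. exact. Qed.

Section measurable_rV.
Context {d} {T : sigmaRingType d} (n : nat).

Let coord : 'I_n -> 'rV[T]_n -> T := fun i x => x ord0 i.

Let rV_set0 : g_sigma_preimage coord set0.
Proof. exact: sigma_algebra0. Qed.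

Let rV_setC A : g_sigma_preimage coord A -> g_sigma_preimage coord (~` A).
Proof. exact: sigma_algebraC. Qed.

Let rV_bigcup (F : _^nat) : (forall i, g_sigma_preimage coord (F i)) ->
  g_sigma_preimage coord (\bigcup_i (F i)).
Proof. exact: sigma_algebra_bigcup. Qed.

HB.instance Definition _ := @isMeasurable.Build (measure_rV_display d)
  'rV[T]_n (g_sigma_preimage coord) rV_set0 rV_setC rV_bigcup.

End measurable_rV.


Section measurable_rV_theory.
Context {d d'} {T : measurableType d} {U : measurableType d'} {n : nat}.

Lemma measurable_coord (i : 'I_n) :
  measurable_fun [set: 'rV[T]_n] (fun x => x ord0 i).
Proof.
move=> _ A mA; rewrite setTI; apply: sub_sigma_algebra => /=.
rewrite -bigcup_seq/=; exists i => /=; first by rewrite mem_index_enum.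
by exists A => //; rewrite setTI.
Qed.

Lemma measurable_fun_rV (f : U -> 'rV[T]_n) :
  (forall i, measurable_fun [set: U] (fun x => f x ord0 i)) ->
  measurable_fun [set: U] f.
Proof.
move=> mf; apply: (@measurability _ _ U 'rV[T]_n setT f _ erefl).
move=> _ [A + <-]; rewrite -bigcup_seq/= => -[i _ [B mB <-]].
by rewrite setTI setTI; rewrite -[X in measurable X]setTI; exact: mf.
Qed.

End measurable_rV_theory.

Definition cons_rV (T : Type) (n : nat) (p : T * 'rV[T]_n) : 'rV[T]_n.+1 :=
  \row_(i < n.+1) oapp (p.2 ord0) p.1 (unlift ord0 i).

Lemma measurable_cons_rV d (T : measurableType d) (n : nat) :
  measurable_fun [set: T * 'rV[T]_n] (@cons_rV T n).
Proof.
apply: measurable_fun_rV => i.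
case: (unliftP ord0 i) => [j ->|->]; last first.
  rewrite (_ : (fun _ => _) = fst); first exact: measurable_fst.
  by apply/funext => x; rewrite mxE unlift_none.
rewrite (_ : (fun _ => _) = (fun x : 'rV[T]_n => x ord0 j) \o snd).
  by apply: measurableT_comp; [exact: measurable_coord|exact: measurable_snd].
by apply/funext => x; rewrite mxE liftK.
Qed.

Section lebesgue_rV_step.
Context {R : realType} {n : nat} (m : {sigma_finite_measure set 'rV[R]_n -> \bar R}).
Local Open Scope ereal_scope.

Definition lebesgue_rV_step : set 'rV[R]_n.+1 -> \bar R :=
  pushforward (@lebesgue_measure R \x m) (@cons_rV R n).

Let step0 : lebesgue_rV_step set0 = 0.
Proof. by rewrite /lebesgue_rV_step /pushforward preimage_set0 measure0. Qed.

Let step_ge0 A : 0 <= lebesgue_rV_step A.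
Proof. exact: (measure_ge0 (lebesgue_measure \x m)). Qed.

Let step_sigma_additive : semi_sigma_additive lebesgue_rV_step.
Proof.
move=> F mF tF mUF; rewrite /lebesgue_rV_step /pushforward preimage_bigcup.
have mpre (A : set 'rV[R]_n.+1) : measurable A ->
    measurable (@cons_rV R n @^-1` A).
  by move=> mA; rewrite -[X in measurable X]setTI; exact: measurable_cons_rV.
apply: (@measure_semi_sigma_additive _ _ _ (lebesgue_measure \x m)).
- by move=> k; exact: mpre.
- apply/trivIsetP => /= i j _ _ ij; rewrite -preimage_setI.
  by move/trivIsetP : tF => /(_ _ _ _ _ ij) ->//; rewrite preimage_set0.
- by rewrite -preimage_bigcup; exact: mpre.
Qed.

HB.instance Definition _ := isMeasure.Build _ _ _ lebesgue_rV_step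
  step0 step_ge0 step_sigma_additive.

Lemma lebesgue_rV_stepE (A : set R) (B : set 'rV[R]_n) :
  measurable A -> measurable B ->
  lebesgue_rV_step [set x | A (x ord0 ord0) /\ B (\row_i x ord0 (lift ord0 i))]
  = lebesgue_measure A * m B.
Proof.
move=> mA mB; rewrite /lebesgue_rV_step /pushforward.
rewrite -(@product_measure1E _ _ _ _ _ lebesgue_measure m)//; congr (_ \x _).
apply/seteqP; split => -[x y]/=; rewrite /cons_rV/= mxE unlift_none/=;
  by rewrite (_ : \row_i _ = y)//; apply/rowP => i; rewrite !mxE liftK.
Qed.

Lemma measurable_cons_set (A : set R) (B : set 'rV[R]_n) :
  measurable A -> measurable B ->
  measurable [set x : 'rV[R]_n.+1 |
    A (x ord0 ord0) /\ B (\row_i x ord0 (lift ord0 i))].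
Proof.
move=> mA mB; apply: measurableI.
  by rewrite -[X in measurable X]setTI; exact: measurable_coord.
rewrite -[X in measurable X]setTI.
suff: measurable_fun setT
  (fun x : 'rV[R]_n.+1 => \row_i x ord0 (lift ord0 i) : 'rV[R]_n) by exact.
apply: measurable_fun_rV => i.
rewrite (_ : (fun _ => _) = (fun x : 'rV[R]_n.+1 => x ord0 (lift ord0 i))).
  exact: measurable_coord.
by apply/funext => x; rewrite mxE.
Qed.

Let step_sigma_finite : sigma_finite setT lebesgue_rV_step.
Proof.
have /sigma_finiteP[F [TF ndF Foo]] := sigma_finiteT (@lebesgue_measure R).
have /sigma_finiteP[G [TG ndG Goo]] := sigma_finiteT m.
exists (fun k => [set x : 'rV[R]_n.+1 | F k (x ord0 ord0) /\
                          G k (\row_i x ord0 (lift ord0 i))]).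
  apply/esym; rewrite -subTset => x _.
  have : setT (x ord0 ord0) by []. rewrite TF => -[i _ Fi].
  have : setT (\row_i x ord0 (lift ord0 i)) by []. rewrite TG => -[j _ Gj].
  exists (maxn i j) => //; split.
  - by move: Fi; exact/subsetPset/ndF/leq_maxl.
  - by move: Gj; exact/subsetPset/ndG/leq_maxr.
move=> k; have [? ?] := Foo k; have [? ?] := Goo k; split.
  exact: measurable_cons_set.
by rewrite lebesgue_rV_stepE// lte_mul_pinfty// ge0_fin_numE.
Qed.

HB.instance Definition _ := Measure_isSigmaFinite.Build _ _ _ lebesgue_rV_step
  step_sigma_finite.

End lebesgue_rV_step.

(* Lebesgue measure on R^n, as the n-fold product of the Lebesgue measure on R
   (the point mass for n = 0). *)
Fixpoint lebesgue_rV (R : realType) (n : nat) :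
    {sigma_finite_measure set 'rV[R]_n -> \bar R} :=
  match n with
  | 0 => \d_(0 : 'rV[R]_0)
  | n'.+1 => lebesgue_rV_step (lebesgue_rV R n')
  end.

Lemma lebesgue_rV_prod (R : realType) (n : nat) (A : 'I_n -> set R) :
  (forall i, measurable (A i)) ->
  lebesgue_rV R n [set x | forall i, A i (x ord0 i)] =
  (\prod_(i < n) lebesgue_measure (A i))%E.
Proof.
elim: n A => [|n IH] A mA /=.
  by rewrite big_ord0 diracE mem_set// => -[].
have mB : measurable [set x : 'rV[R]_n | forall i, A (lift ord0 i) (x ord0 i)].
  rewrite (_ : mkset _ = \bigcap_(i in [set: 'I_n])
      ((fun x : 'rV[R]_n => x ord0 i) @^-1` A (lift ord0 i))).
    apply: fin_bigcap_measurable => // i _.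
    by rewrite -[X in measurable X]setTI; exact: measurable_coord.
  by apply/seteqP; split => x /= h i; [move=> _|]; exact: h.
rewrite big_ord_recl -IH// -lebesgue_rV_stepE//.
congr (lebesgue_rV_step _ _); apply/seteqP; split => x/=.
  by move=> h; split=> // i; rewrite mxE.
move=> [h0 h] i; case: (unliftP ord0 i) => [j ->|->//].
by have := h j; rewrite mxE.
Qed.

Section sampling.
Context {R : realType} {d : nat}.
Local Notation leb := (lebesgue_rV R d).
Implicit Types (V : 'rV[R]_d -> R) (x y : 'rV[R]_d) (h : R).

(* Squared Euclidean norm; the library norm [`|x|] on row vectors is the
   sup norm. *)
Definition sqnorm x : R := \sum_(i < d) x ord0 i ^+ 2.

Definition gradient V x : 'rV[R]_d := \row_(i < d) 'D_(delta_mx ord0 i) V x.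

(* The probability distribution with density proportional to exp(- V). *)
Definition gibbs_pdf V x : R :=
  expR (- V x) / fine (\int[leb]_z (expR (- V z))%:E)%E.

Definition gibbs V (A : set 'rV[R]_d) : \bar R :=
  (\int[leb]_(x in A) (gibbs_pdf V x)%:E)%E.

(* Density of N(m, v I_d); [v] is the variance of each coordinate. *)
Definition isotropic_gaussian_pdf (m : 'rV[R]_d) (v : R) y : R :=
  (2 * pi * v) `^ (- (d%:R / 2)) * expR (- (sqnorm (y - m) / (2 * v))).

Definition mala_proposal_pdf V h x y : R :=
  isotropic_gaussian_pdf (x - h *: gradient V x) (2 * h) y.

Definition mala_acceptance V h x y : R :=
  Num.min 1 ((gibbs_pdf V y * mala_proposal_pdf V h y x) /
             (gibbs_pdf V x * mala_proposal_pdf V h x y)).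

Definition mala_kernel V h x (B : set 'rV[R]_d) : \bar R :=
  (\int[leb]_(y in B) (mala_proposal_pdf V h x y * mala_acceptance V h x y)%:E
   + (\1_B x)%:E * (1 - \int[leb]_y (mala_proposal_pdf V h x y *
                                     mala_acceptance V h x y)%:E))%E.

End sampling.

Section gibbs_measure.
Context {R : realType} {d : nat} (V : {mfun 'rV[R]_d >-> R}).
Local Notation leb := (lebesgue_rV R d).

Lemma gibbs_pdf_ge0 x : 0 <= gibbs_pdf V x.
Proof.
by rewrite /gibbs_pdf divr_ge0 ?expR_ge0// fine_ge0// integral_ge0.
Qed.

Lemma measurable_gibbs_pdf : measurable_fun setT (gibbs_pdf V).
Proof.
apply: measurable_funM => //; apply: measurableT_comp => //=.
exact: measurableT_comp.
Qed.

Let gibbs0 : gibbs V set0 = 0%E.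
Proof. by rewrite /gibbs integral_set0. Qed.

Let gibbs_ge0 A : (0 <= gibbs V A)%E.
Proof. by apply: integral_ge0 => x _; rewrite lee_fin gibbs_pdf_ge0. Qed.

Let gibbs_sigma_additive : semi_sigma_additive (gibbs V).
Proof.
move=> F mF tF mUF; rewrite /gibbs ge0_integral_bigcup//=.
- apply: is_cvg_ereal_nneg_natsum_cond => k _ _; exact: gibbs_ge0.
- apply/measurable_EFinP; apply: measurable_funTS; exact: measurable_gibbs_pdf.
- by move=> x _; rewrite lee_fin gibbs_pdf_ge0.
Qed.

HB.instance Definition _ := isMeasure.Build _ _ _ (gibbs V)
  gibbs0 gibbs_ge0 gibbs_sigma_additive.

End gibbs_measure.

Definition conductance d (T : measurableType d) (R : realType)
    (mu : {measure set T -> \bar R}) (K : T -> set T -> \bar R) : \bar R :=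
  ereal_inf [set ((\int[mu]_(x in S) K x (~` S)) / mu S)%E | S in
    [set S : set T | measurable S /\ (0 < mu S <= (2^-1)%:E)%E]].

Section cosine_potential.
Context {R : realType} (d : nat) (eta : R).

Definition cosine_potential (x : 'rV[R]_d) : R :=
  sqnorm x / 2 -
  (2 * d%:R `^ (2 * eta))^-1 * \sum_(i < d) cos (d%:R `^ eta * x ord0 i).

Let measurable_cosine_potential : measurable_fun setT cosine_potential.
Proof.
apply: measurable_funB.
  apply: measurable_funM => //; apply: measurable_sum => i.
  by apply: measurable_funX; exact: measurable_coord.
apply: measurable_funM => //; apply: measurable_sum => i.
apply: (@measurableT_comp _ _ _ _ _ _ cos) => /=.
  exact: (continuous_measurable_fun (@continuous_cos R)).
by apply: measurable_funM => //; exact: measurable_coord.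
Qed.

HB.instance Definition _ := isMeasurableFun.Build _ _ _ _ cosine_potential
  measurable_cosine_potential.

End cosine_potential.

Arguments cosine_potential {R} d eta x.

(* Main.v *)
Require Import Defs.
From mathcomp Require Import all_boot all_order all_algebra.
From mathcomp Require Import all_classical all_reals all_analysis.
From mathcomp Require Import measurable_realfun ring lra.
Import Order.TTheory GRing.Theory Num.Theory.
Import numFieldNormedType.Exports.
Local Open Scope classical_set_scope.
Local Open Scope ring_scope.

(** Write p for the density of the target and q(x, y) for the proposal density.
For the half-space S where one chosen coordinate is nonnegative, symmetry gives
pi(S) = 1/2, and a move out of S has to be accepted, so the conductance is at
most twice the average acceptance probability of the stationary chain. With
X = p(x) q(x, y) and Y = p(y) q(y, x) one has X min(1, Y / X) <= sqrt (X Y), and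
both X and Y factor over the coordinates. Hence the average acceptance
probability is at most rho ^ d, where rho is the integral over the plane of
sqrt (X Y) for the one-dimensional chain (escape_le, conductance_le_affinity).

In dimension one, X and its transpose Y are probability densities, so
rho = 1 - H / 2, with H the integral of (sqrt X - sqrt Y)^2
(overlap_le_of_hellinger), and it remains to show that H is at least of order
h / w^2, where w = d^eta is the frequency of the cosine perturbation. The
logarithm of Y / X is
  (cos wb - cos wa) / (2 w^2) + (b - a) (sin wa + sin wb) / (4 w)
    + h / 4 (v'(a)^2 - v'(b)^2),
because the quadratic part of the potential is integrated exactly by the
trapezoidal rule. For b - a comparable to s = sqrt h, the middle term has size
s / w; the first one has size 1 / w^2, smaller because w s is large, and the last
one has size s^3 + s^2 / w, smaller because s^2 w and s are small
(coord_log_ratio_bounds). So (sqrt X - sqrt Y)^2 is of order X s^2 / w^2 wherever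
|sin wa + sin wb| >= 1/2. Such points fill a fixed proportion of the strip
s <= b - a <= 3 s: shifting a by pi / (2 w) turns sin wa into cos wa, shifting b
by pi / w changes the sign of sin wb, both shifts are short compared with s, and
one of the four shifts of any given point is good
(exists_shift_sin_sum_ge). Translation invariance of Lebesgue measure turns this
into a lower bound for H (integral_four_shifts, coord_affinity_ub).

Finally rho ^ d <= exp (- c d h / w^2), and d h / w^2 >= d^(5 delta) when
h >= d^(-1/2 + 3 delta) and w = d^(1/4 - delta). The smallness conditions on
w and s hold once d is large; for the remaining d the bound rho <= 1 suffices
after enlarging C0. *)

(** * Integrals of nonnegative functions, densities and translations *)

(** The integral of a nonnegative function is a supremum over the simple functions
below it, hence is monotone for arbitrary nonnegative functions; here it is applied to
the kernel of the chain as a function of its starting point. *)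
Lemma le_integral_nonneg d (T : measurableType d) (R : realType)
    (mu : {measure set T -> \bar R}) (D : set T) (f g : T -> \bar R) :
  (forall x, D x -> (0 <= f x)%E) -> (forall x, D x -> (f x <= g x)%E) ->
  (\int[mu]_(x in D) f x <= \int[mu]_(x in D) g x)%E.
Proof.
move=> f0 fg.
have g0 x : D x -> (0 <= g x)%E by move=> Dx; exact: le_trans (f0 x Dx) (fg x Dx).
rewrite ge0_integralE// [leRHS]ge0_integralE//.
apply: ereal_sup_le => _ [h hf <-]; exists h => // x.
apply: le_trans (hf x) _; rewrite /patch; case: ifP => // /set_mem; exact: fg.
Qed.

Section density.
Context d (T : measurableType d) (R : realType).
Variables (mu nu : {measure set T -> \bar R}) (p : T -> R).
Hypothesis p_ge0 : forall x, 0 <= p x.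
Hypothesis mp : measurable_fun [set: T] p.
Hypothesis nuE : forall A, measurable A ->
  nu A = (\int[mu]_(x in A) (p x)%:E)%E.
Local Open Scope ereal_scope.
Import HBNNSimple.

(** Both sides are limits along the same increasing sequence of simple functions,
and on indicators the formula is the definition of a density. *)
Lemma ge0_integral_density (f : T -> \bar R) : (forall x, 0 <= f x) ->
  measurable_fun [set: T] f ->
  \int[nu]_x f x = \int[mu]_x (f x * (p x)%:E).
Proof.
move=> f0 mf; pose h := nnsfun_approx measurableT mf.
have hf x : (EFin \o h n) x @[n --> \oo] --> f x.
  by apply: cvg_nnsfun_approx => // ? _; exact: f0.
have mEp : measurable_fun [set: T] (EFin \o p) by exact/measurable_EFinP.
have -> : \int[nu]_x f x = lim (\int[nu]_x (EFin \o h n) x @[n --> \oo]).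
  under eq_integral do rewrite -(cvg_lim _ (hf _))//.
  apply: monotone_convergence => //.
  - by move=> n; exact/measurable_EFinP.
  - by move=> n x _ //=; rewrite lee_fin.
  - by move=> x _ a b ab; rewrite lee_fin; exact/lefP/nd_nnsfun_approx.
have -> : \int[mu]_x (f x * (p x)%:E) =
    lim (\int[mu]_x ((EFin \o h n) x * (p x)%:E) @[n --> \oo]).
  have hfp x : (EFin \o h n) x * (p x)%:E @[n --> \oo] --> f x * (p x)%:E.
    by apply: cvgeZr => //; exact: hf.
  under eq_integral do rewrite -(cvg_lim _ (hfp _))//.
  apply: (@monotone_convergence _ _ _ _ _ _
    (fun n x => (EFin \o h n) x * (p x)%:E)) => //.
  - by move=> n; apply/emeasurable_funM => //; exact/measurable_EFinP.
  - by move=> n x _ /=; rewrite mule_ge0 ?lee_fin.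
  - move=> x _ a b ab/=; rewrite lee_wpmul2r ?lee_fin//.
    exact/lefP/nd_nnsfun_approx.
suff suf n : \int[nu]_x (EFin \o h n) x = \int[mu]_x ((EFin \o h n) x * (p x)%:E).
  by congr (lim (_ @ \oo)); apply/funext => n; exact: suf.
have indich r : measurable_fun [set: T] (fun x => (r * \1_(h n @^-1` [set r]) x)%:E).
  by apply/measurable_EFinP; exact: measurable_funM.
transitivity (\int[nu]_x
   (\sum_(y \in range (h n)) (y * \1_(h n @^-1` [set y]) x)%:E)).
  by apply: eq_integral => t tE; rewrite /= fimfunE -fsumEFin.
rewrite ge0_integral_fsum//; last by move=> m y Ey; exact: nnfun_muleindic_ge0.
transitivity (\int[mu]_x (\sum_(y \in range (h n))
    (y * \1_(h n @^-1` [set y]) x)%:E * (p x)%:E)); last first.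
  apply: eq_integral => x _.
  rewrite -ge0_mule_fsuml => [|y]; last exact: nnfun_muleindic_ge0.
  by rewrite fsumEFin// -(fimfunE _ x).
rewrite [RHS]ge0_integral_fsum//; last 2 first.
  - by move=> y; apply: emeasurable_funM.
  - by move=> y x _; rewrite mule_ge0 ?lee_fin//; exact: nnfun_muleindic_ge0.
apply: eq_fsbigr => r rhn.
rewrite integralZl_indic_nnsfun// integral_indic// setIT nuE//.
under [RHS]eq_integral do rewrite EFinM -muleA.
rewrite ge0_integralZl//.
- rewrite integral_mkcond; congr (_ * _); apply: eq_integral => x _.
  by rewrite patchE indicE; case: ifPn => _; rewrite ?mul1e ?mul0e.
- by apply: emeasurable_funM => //; exact/measurable_EFinP.
- by move=> x _; rewrite mule_ge0 ?lee_fin.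
- by move: rhn; rewrite inE => -[t _ <-]; rewrite lee_fin.
Qed.

End density.

Section translation.
Context {R : realType}.
Local Open Scope ereal_scope.
Local Notation mu := (@lebesgue_measure R).

(** A translate of Lebesgue measure agrees with it on half-open intervals, hence
everywhere. *)
Lemma ge0_integral_shift (a : R) (f : R -> \bar R) : (forall x, 0 <= f x) ->
  measurable_fun [set: R] f ->
  \int[mu]_x f (x + a)%R = \int[mu]_x f x.
Proof.
move=> f0 mf; pose phi : measurableTypeR R -> measurableTypeR R := fun x => (x + a)%R.
have mphi : measurable_fun setT phi by exact: measurable_funD.
have := @ge0_integral_pushforward _ _ _ _ R phi mphi mu setT f.
rewrite preimage_setT => <-//.
apply: eq_measure_integral => A mA _.
apply/esym/lebesgue_measure_unique => //= _ [[x y]] _ <-.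
rewrite /pushforward.
have -> : phi @^-1` [set` `]x, y]] = `](x - a)%R, (y - a)%R]%classic.
  by apply/seteqP; split => z; rewrite /phi /= !in_itv/= lerBrDr ltrBlDr.
rewrite !lebesgue_measure_itv/= !lte_fin ltrD2r; case: ifP => //.
by rewrite -!EFinB opprB addrA subrK.
Qed.

End translation.

(** * Integrals of products over the coordinates *)

Section product.
Context {R : realType}.
Local Open Scope ereal_scope.

Lemma emeasurable_prod d (T : measurableType d) (I : Type) (s : seq I)
    (h : I -> T -> \bar R) : (forall i, measurable_fun [set: T] (h i)) ->
  measurable_fun [set: T] (fun x => \prod_(i <- s) h i x).
Proof.
move=> mh; elim: s => [|i s IH].
  by under eq_fun do rewrite big_nil; exact: measurable_cst.
by under eq_fun do rewrite big_cons; exact: emeasurable_funM.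
Qed.

Lemma ge0_integral_rV_cons n (f : 'rV[R]_n.+1 -> \bar R) :
  (forall x, 0 <= f x) -> measurable_fun [set: 'rV[R]_n.+1] f ->
  \int[lebesgue_rV R n.+1]_x f x =
  \int[lebesgue_measure]_a \int[lebesgue_rV R n]_x f (cons_rV (a, x)).
Proof.
move=> f0 mf.
transitivity (\int[pushforward (@lebesgue_measure R \x lebesgue_rV R n)
    (@cons_rV R n)]_x f x); first by [].
pose mu2 := [the {measure set _ -> \bar R} of @lebesgue_measure R \x lebesgue_rV R n].
rewrite -[\int[_]_x f x]/(\int[pushforward mu2 (@cons_rV R n)]_x f x).
have H phi m := @ge0_integral_pushforward _ _ _ _ R phi m
  mu2 setT f measurableT mf.
rewrite (H (@cons_rV R n)); [|exact: measurable_cons_rV|by move=> x _; exact: f0].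
rewrite preimage_setT.
rewrite /mu2 fubini_tonelli1//; last by move=> x; exact: f0.
by apply: measurableT_comp => //; exact: measurable_cons_rV.
Qed.

(** Tonelli, one coordinate at a time. *)
Lemma integral_rV_prod n (g : 'I_n -> R -> \bar R) :
  (forall i a, 0 <= g i a) -> (forall i, measurable_fun [set: R] (g i)) ->
  \int[lebesgue_rV R n]_x (\prod_(i < n) g i (x ord0 i)) =
  \prod_(i < n) \int[lebesgue_measure]_a g i a.
Proof.
elim: n g => [|n IH] g g0 mg.
  rewrite big_ord0; under eq_integral do rewrite big_ord0.
  by rewrite integral_cst//= diracT mul1e.
rewrite ge0_integral_rV_cons; first last.
- apply: emeasurable_prod => i.
  exact: (measurableT_comp (mg i) (measurable_coord _)).
- by move=> x; exact: prode_ge0.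
rewrite big_ord_recl -IH//.
have P0 (x : 'rV[R]_n) : 0 <= \prod_(i < n) g (lift ord0 i) (x ord0 i).
  by apply: prode_ge0 => i _.
transitivity (\int[lebesgue_measure]_a (g ord0 a *
   \int[lebesgue_rV R n]_x \prod_(i < n) g (lift ord0 i) (x ord0 i))).
  apply: eq_integral => a _; rewrite -ge0_integralZl//.
  - apply: eq_integral => x _; rewrite big_ord_recl /cons_rV !mxE unlift_none/=.
    by congr (_ * _); apply: eq_bigr => i _; rewrite mxE liftK.
  - apply: emeasurable_prod => i.
    exact: (measurableT_comp (mg _) (measurable_coord _)).
by rewrite ge0_integralZr//; [exact: mg|apply: integral_ge0 => x _].
Qed.

End product.

(** * Hellinger distance and shifts in the plane *)

Section plane.
Context {R : realType}.
Local Notation mu := (@lebesgue_measure R).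
Local Notation mu2 := (@lebesgue_measure R \x @lebesgue_measure R)%E.

Lemma ge0_integral_plane (f : R * R -> \bar R) : (forall p, 0 <= f p)%E ->
  measurable_fun [set: R * R] f ->
  (\int[mu2]_p f p = \int[mu]_a \int[mu]_b f (a, b))%E.
Proof. by move=> f0 mf; rewrite (@fubini_tonelli1 _ _ _ _ _ mu mu f). Qed.

Lemma ge0_integral_plane_swap (f : R * R -> \bar R) : (forall p, 0 <= f p)%E ->
  measurable_fun [set: R * R] f ->
  (\int[mu2]_p f (p.2, p.1) = \int[mu2]_p f p)%E.
Proof.
move=> f0 mf; rewrite (@fubini_tonelli2 _ _ _ _ _ mu mu f)//.
rewrite ge0_integral_plane//.
by apply: measurableT_comp => //; exact: measurable_swap.
Qed.

Lemma ge0_integral_plane_shift (u v : R) (f : R * R -> \bar R) :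
  (forall p, 0 <= f p)%E -> measurable_fun [set: R * R] f ->
  (\int[mu2]_p f ((p.1 + u)%R, (p.2 + v)%R) = \int[mu2]_p f p)%E.
Proof.
move=> f0 mf; rewrite [LHS]ge0_integral_plane//; last first.
  apply: measurableT_comp => //; apply: measurable_fun_pair => /=.
    by apply: measurable_funD => //; exact: measurable_fst.
  by apply: measurable_funD => //; exact: measurable_snd.
rewrite ge0_integral_plane//.
have mF := @measurable_fun_fubini_tonelli_F _ _ _ _ _ mu f mf f0.
rewrite -(ge0_integral_shift u (fun a => \int[mu]_b f (a, b))%E); last 2 first.
- by move=> a; apply: integral_ge0.
- exact: mF.
apply: eq_integral => a _ /=.
rewrite -(ge0_integral_shift v (fun b => f ((a + u)%R, b)))//.
by apply: measurableT_comp => //; exact: pair1_measurable.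
Qed.

(** Integrate 2 sqrt (X Y) + (sqrt X - sqrt Y)^2 = X + Y, where Y is the transpose of
X and thus also has mass 1. *)
Lemma overlap_le_of_hellinger (X : R * R -> R) (D : R) :
  (forall p, 0 <= X p) -> measurable_fun [set: R * R] X ->
  (\int[mu2]_p (X p)%:E = 1)%E ->
  (D%:E <= \int[mu2]_p
     ((Num.sqrt (X p) - Num.sqrt (X (p.2, p.1))) ^+ 2)%:E)%E ->
  (\int[mu2]_p (Num.sqrt (X p * X (p.2, p.1)))%:E <= (1 - D / 2)%:E)%E.
Proof.
move=> X0 mX X1 DQ.
have mX' : measurable_fun [set: R * R] (fun p => X (p.2, p.1)).
  by apply: (measurableT_comp mX); exact: measurable_swap.
have X'1 : (\int[mu2]_p (X (p.2, p.1))%:E = 1)%E.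
  rewrite (ge0_integral_plane_swap (EFin \o X)) //=.
  exact/measurable_EFinP.
have msqrt (f : R * R -> R) : measurable_fun [set: R * R] f ->
    measurable_fun [set: R * R] (Num.sqrt \o f).
  move=> mf; apply: measurableT_comp => //.
  exact: (continuous_measurable_fun (@sqrt_continuous R)).
have mA : measurable_fun [set: R * R] (fun p => Num.sqrt (X p * X (p.2, p.1))).
  by apply: msqrt; exact: measurable_funM.
have mQ : measurable_fun [set: R * R]
    (fun p => (Num.sqrt (X p) - Num.sqrt (X (p.2, p.1))) ^+ 2).
  by apply: measurable_funX; apply: measurable_funB; exact: msqrt.
set A := (\int[mu2]_p (Num.sqrt (X p * X (p.2, p.1)))%:E)%E.
set Q := (\int[mu2]_p _)%E in DQ.
have A0 : (0 <= A)%E by apply: integral_ge0 => p _; rewrite lee_fin sqrtr_ge0.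
have Q0 : (0 <= Q)%E by apply: integral_ge0 => p _; rewrite lee_fin sqr_ge0.
have E : (2%:E * A + Q = 2%:E)%E.
  transitivity (\int[mu2]_p (X p)%:E + \int[mu2]_p (X (p.2, p.1))%:E)%E;
    last by rewrite X1 X'1.
  rewrite -ge0_integralZl//; last exact/measurable_EFinP.
  rewrite -ge0_integralD//; [|by apply/measurable_EFinP; exact: measurable_funM
    |by move=> p _; rewrite lee_fin sqr_ge0|exact/measurable_EFinP].
  rewrite -ge0_integralD//; do ?[exact/measurable_EFinP
    |by move=> p _; rewrite lee_fin].
  apply: eq_integral => p _; rewrite -!EFinD; congr EFin.
  rewrite sqrtrM// sqrrB !sqr_sqrtr//; ring.
case: A A0 E => [A| |] A0 E; last 2 first.
- by move: E; rewrite mulry gtr0_sg// mul1e; case: Q Q0 {DQ}.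
- by [].
case: Q Q0 E DQ => [Q| |] Q0 E DQ; last 2 first.
- by [].
- by [].
move: E DQ; rewrite !lee_fin -EFinM -EFinD => -[E] DQ; lra.
Qed.

(** Summing the four translates of f leaves at least k at each point of a strip of
area s, while each translate has the same integral as f. *)
Lemma integral_four_shifts (f : R * R -> R) (k s u v : R) :
  (forall p, 0 <= f p) -> measurable_fun [set: R * R] f ->
  0 <= k -> 0 < s ->
  (forall a b, 0 <= a <= 1 -> 3 / 2 * s <= b - a <= 5 / 2 * s ->
    exists e : bool * bool, k <= f (a + e.1%:R * u, b + e.2%:R * v)) ->
  ((k * s / 4)%:E <= \int[mu2]_p (f p)%:E)%E.
Proof.
move=> f0 mf k0 s0 H.
pose g (e : bool * bool) (p : R * R) := (f (p.1 + e.1%:R * u, p.2 + e.2%:R * v))%:E.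
have g0 e p : (0 <= g e p)%E by rewrite lee_fin.
have mg e : measurable_fun [set: R * R] (g e).
  apply/measurable_EFinP; apply: measurableT_comp => //.
  apply: measurable_fun_pair => /=.
    by apply: measurable_funD => //; exact: measurable_fst.
  by apply: measurable_funD => //; exact: measurable_snd.
have gE e : (\int[mu2]_p g e p = \int[mu2]_p (f p)%:E)%E.
  by rewrite -(ge0_integral_plane_shift (e.1%:R * u) (e.2%:R * v) (EFin \o f))//;
    exact/measurable_EFinP.
have S4 : (\int[mu2]_p \sum_(e : bool * bool) g e p =
    4%:E * \int[mu2]_p (f p)%:E)%E.
  rewrite ge0_integral_sum//.
  under eq_bigr do rewrite gE.
  by rewrite sumr_const card_prod card_bool mule_natl.
suff : ((k * s)%:E <= 4%:E * \int[mu2]_p (f p)%:E)%E.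
  move=> ks; have -> : (\int[mu2]_p (f p)%:E)%E =
      (4^-1%:E * (4%:E * \int[mu2]_p (f p)%:E))%E.
    by rewrite muleA -EFinM mulVf// mul1e.
  by rewrite [k * s / 4]mulrC EFinM lee_wpmul2l.
rewrite -S4 ge0_integral_plane; first last.
- exact: emeasurable_sum.
- by move=> p; apply: sume_ge0 => e _.
have <- : (\int[mu]_(a in `[0%R, 1%R]) (k * s)%:E = (k * s)%:E)%E.
  rewrite integral_cst//= lebesgue_measure_itv/= lte_fin ltr01 sube0.
  by rewrite mule1.
rewrite integral_mkcond; apply: le_integral_nonneg => a _.
  by rewrite patchE; case: ifP => // _; rewrite lee_fin mulr_ge0// ltW.
rewrite patchE; case: ifPn => [|_]; last first.
  by apply: integral_ge0 => b _; apply: sume_ge0 => e _.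
rewrite inE/= in_itv/= => a01.
have <- : (\int[mu]_(b in `[(a + 3 / 2 * s)%R, (a + 5 / 2 * s)%R]) k%:E = (k * s)%:E)%E.
  rewrite integral_cst//= lebesgue_measure_itv/= lte_fin ltrD2l ltr_pM2r//.
  rewrite ifT; last by lra.
  by rewrite -EFinB -EFinM; congr EFin; field.
rewrite integral_mkcond; apply: le_integral_nonneg => b _.
  by rewrite patchE; case: ifP => // _; rewrite lee_fin.
rewrite patchE; case: ifPn => [|_]; last by apply: sume_ge0 => e _.
rewrite inE/= in_itv/= => bs.
(* One good shift suffices: the other three terms are nonnegative. *)
have [|e ke] := H a b a01; first by lra.
rewrite (bigD1 e)//= -[leLHS]adde0; apply: leeD; first by rewrite lee_fin.
by apply: sume_ge0 => ? _.
Qed.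

End plane.

(** * The chain in one coordinate *)

Section coordinate.
Context {R : realType}.
Implicit Types w h s a b : R.
Local Notation mu := (@lebesgue_measure R).
Local Notation mu2 := (@lebesgue_measure R \x @lebesgue_measure R)%E.

Definition coord_potential w a : R := a ^+ 2 / 2 - cos (w * a) / (2 * w ^+ 2).

Definition coord_drift w a : R := a + sin (w * a) / (2 * w).

(** Up to an additive constant, the logarithm of the joint density of a point a of
the target and of a proposal b made from a. *)
Definition coord_exponent w h a b : R :=
  - coord_potential w a - (b - (a - h * coord_drift w a)) ^+ 2 / (2 * (2 * h)).

(** The quadratic part of the potential cancels: the trapezoidal rule is exact for
it. *)
Lemma coord_log_ratioE w h a b : w != 0 -> h != 0 ->
  coord_exponent w h b a - coord_exponent w h a b =
  (cos (w * b) - cos (w * a)) / (2 * w ^+ 2)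
  + (b - a) * (sin (w * a) + sin (w * b)) / (4 * w)
  + h / 4 * (coord_drift w a ^+ 2 - coord_drift w b ^+ 2).
Proof.
move=> w0 h0; rewrite /coord_exponent /coord_potential /coord_drift; field.
by rewrite w0 h0.
Qed.

Lemma coord_drift_bounds w a : 1 <= w -> 0 <= a ->
  - 2^-1 <= coord_drift w a <= a + 2^-1.
Proof.
move=> w1 a0; have w0 : 0 < w by lra.
have u0 : 0 < w^-1 by rewrite invr_gt0.
have u1 : w^-1 <= 1 by rewrite invf_le1.
rewrite /coord_drift invfM.
have := sin_geN1 (w * a); have := sin_le1 (w * a).
move: (sin _) => t t1 t2; apply/andP; split; nra.
Qed.

Lemma coord_potential_bounds w a : 1 <= w ->
  a ^+ 2 / 2 - 2^-1 <= coord_potential w a <= a ^+ 2 / 2 + 2^-1.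
Proof.
move=> w1; have w0 : 0 < w by lra.
have u0 : 0 < (w ^+ 2)^-1 by rewrite invr_gt0 exprn_gt0.
have u1 : (w ^+ 2)^-1 <= 1 by rewrite invf_le1 ?exprn_gt0// expr_ge1// ltW.
rewrite /coord_potential invfM.
have := cos_geN1 (w * a); have := cos_le1 (w * a).
move: (cos _) => t t1 t2; apply/andP; split; nra.
Qed.

(** On this part of the strip the joint density keeps its natural order 1 / s, the
factor 1 / s being the normalization of the proposal. *)
Lemma coord_exponent_ge w s a b : 1 <= w -> 0 < s -> s <= 100^-1 ->
  0 <= a -> a <= 2 -> s <= b - a -> b - a <= 3 * s ->
  - 7 <= coord_exponent w (s ^+ 2) a b.
Proof.
move=> w1 s_gt0 s_small a_ge0 a_le2 ab_lb ab_ub; rewrite /coord_exponent.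
have /andP[_ P] := coord_potential_bounds w a w1.
have /andP[D1 D2] := coord_drift_bounds w a w1 a_ge0.
move: (coord_drift w a) D1 D2 => D D1 D2.
have S : (b - (a - s ^+ 2 * D)) ^+ 2 <= 16 * s ^+ 2.
  rewrite [X in _ <= X](_ : _ = (4 * s) ^+ 2); last by ring.
  have s2 : s ^+ 2 <= s / 100 by rewrite expr2 ler_pM2l.
  have s20 : 0 < s ^+ 2 by rewrite exprn_gt0.
  have /andP[E1 E2] : - s <= s ^+ 2 * D <= s.
    have D3 : 0 <= D + 2^-1 by lra.
    have D4 : 0 <= 5 / 2 - D by lra.
    have := mulr_ge0 (ltW s20) D3; have := mulr_ge0 (ltW s20) D4.
    by rewrite mulrBr mulrDr => *; apply/andP; split; lra.
  by rewrite ler_pXn2r ?nnegrE//; lra.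
have : (b - (a - s ^+ 2 * D)) ^+ 2 / (2 * (2 * s ^+ 2)) <= 4.
  rewrite ler_pdivrMr; last by rewrite !mulr_gt0// exprn_gt0.
  by apply: le_trans S _; lra.
nra.
Qed.

(** With u = 1 / w, the term (b - a) (sin wa + sin wb) / (4 w) is at least s u / 8 in
absolute value, and the two other terms are at most s u / 100 and 39 s u / 1000, so
that s u / 16 remains. *)
Lemma coord_log_ratio_bounds w s a b : 1 <= w -> 0 < s -> s <= 100^-1 ->
  100 <= w * s -> s ^+ 2 * w <= 200^-1 ->
  0 <= a -> a <= 2 -> s <= b - a -> b - a <= 3 * s ->
  2^-1 <= `|sin (w * a) + sin (w * b)| ->
  s / (16 * w) <=
    `|coord_exponent w (s ^+ 2) b a - coord_exponent w (s ^+ 2) a b| <= 1.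
Proof.
move=> w1 s_gt0 s_small ws_large sw_small a_ge0 a_le2 ab_lb ab_ub sab.
have w0 : 0 < w by lra.
rewrite coord_log_ratioE; [|by rewrite gt_eqF|by rewrite gt_eqF// exprn_gt0].
have u0 : 0 < w^-1 by rewrite invr_gt0.
have u1 : w^-1 <= 1 by rewrite invf_le1.
set u := w^-1 in u0 u1 *.
have us : u <= s / 100.
  by rewrite /u ler_pdivlMr// mulrC ler_pdivrMr// mulrC.
have s2u : s ^+ 2 <= u / 200.
  by rewrite /u mulrC ler_pdivlMr// mulrC.
have b0 : 0 <= b by lra.
have /andP[A1 A2] := coord_drift_bounds w a w1 a_ge0.
have /andP[B1 B2] := coord_drift_bounds w b w1 b0.
have dd : `|coord_drift w a - coord_drift w b| <= 3 * s + u.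
  have -> : coord_drift w a - coord_drift w b =
     - (b - a) + (sin (w * a) - sin (w * b)) / 2 * u.
    by rewrite /coord_drift /u; field; rewrite gt_eqF.
  have := sin_geN1 (w * a); have := sin_le1 (w * a).
  have := sin_geN1 (w * b); have := sin_le1 (w * b).
  by move: (sin (w * a)) (sin (w * b)) => p q *; rewrite ler_norml; nra.
have E3 : `|s ^+ 2 / 4 * (coord_drift w a ^+ 2 - coord_drift w b ^+ 2)|
    <= s * u * (39 / 1000).
  have sq0 : 0 <= s ^+ 2 / 4 by apply: divr_ge0 => //; exact: sqr_ge0.
  rewrite subr_sqr normrM (ger0_norm sq0) normrM.
  have da : `|coord_drift w a + coord_drift w b| <= 6.
    by rewrite ler_norml; apply/andP; split; lra.
  apply: (@le_trans _ _ (s ^+ 2 / 4 * ((3 * s + u) * 6))).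
    by apply: ler_wpM2l => //; exact: ler_pM.
  rewrite (_ : s ^+ 2 / 4 * ((3 * s + u) * 6) =
    9 / 2 * (s * s ^+ 2) + 3 / 2 * (s * (s * u))); last by field.
  have : s * s ^+ 2 <= s * (u / 200) by rewrite ler_pM2l.
  have : s * (s * u) <= s * (100^-1 * u) by rewrite ler_pM2l// ler_pM2r.
  have : 0 < s * u by rewrite mulr_gt0.
  lra.
have E1 : `|(cos (w * b) - cos (w * a)) / (2 * w ^+ 2)| <= s * u * (1 / 100).
  have -> : (cos (w * b) - cos (w * a)) / (2 * w ^+ 2) =
    (cos (w * b) - cos (w * a)) / 2 * (u * u).
    by rewrite /u; field; rewrite gt_eqF.
  have uu : u * u <= s / 100 * u by rewrite ler_pM2r.
  have uu0 : 0 < u * u by rewrite mulr_gt0.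
  have : `|(cos (w * b) - cos (w * a)) / 2| <= 1.
    have := cos_geN1 (w * a); have := cos_le1 (w * a).
    have := cos_geN1 (w * b); have := cos_le1 (w * b).
    by move=> *; rewrite ler_norml; apply/andP; split; lra.
  move=> c1; rewrite normrM (ger0_norm (ltW uu0)).
  apply: (@le_trans _ _ (1 * (u * u))); first by rewrite ler_pM2r.
  lra.
have -> : (b - a) * (sin (w * a) + sin (w * b)) / (4 * w) =
  (b - a) * (sin (w * a) + sin (w * b)) * (u / 4).
  by rewrite /u; field; rewrite gt_eqF.
have M : s * u / 8 <= `|(b - a) * (sin (w * a) + sin (w * b)) * (u / 4)|
    <= s * u * (3 / 2).
  have u4 : 0 < u / 4 by rewrite divr_gt0.
  have ba0 : 0 <= b - a by lra.
  rewrite normrM (gtr0_norm u4) normrM (ger0_norm ba0).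
  have : `|sin (w * a) + sin (w * b)| <= 2.
    have := sin_geN1 (w * a); have := sin_le1 (w * a).
    have := sin_geN1 (w * b); have := sin_le1 (w * b).
    by move=> *; rewrite ler_norml; apply/andP; split; lra.
  move: (`|_ + _|) sab => S S1 S2.
  have K1 : s * 2^-1 <= (b - a) * S by apply: ler_pM => //; lra.
  have K2 : (b - a) * S <= 3 * s * 2 by apply: ler_pM => //; lra.
  apply/andP; split.
    rewrite (_ : s * u / 8 = s * 2^-1 * (u / 4)); last by field.
    by rewrite ler_pM2r// divr_gt0.
  rewrite (_ : s * u * (3 / 2) = 3 * s * 2 * (u / 4)); last by field.
  by rewrite ler_pM2r// divr_gt0.
have -> : s / (16 * w) = s * u / 16 by rewrite /u; field; rewrite gt_eqF.
move: M E1 E3; set m := (b - a) * _ * _; set e1 := _ / (2 * _).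
set e3 := _ / 4 * _ => /andP[M1 M2] E1 E3.
have su : 0 < s * u by rewrite mulr_gt0.
have su1 : s * u <= 100^-1.
  by rewrite -[leRHS]mulr1 ler_pM// ltW.
apply/andP; split; last first.
  apply: le_trans (ler_normD _ _) _; have := ler_normD e1 m; lra.
have -> : e1 + m + e3 = m - (- e1 - e3) by ring.
apply: le_trans (lerB_dist _ _).
have := ler_normB (- e1) e3; rewrite normrN; lra.
Qed.

(** Both signs of r come from 1 + t <= expR t, at t = r / 2 when r >= 0 and at
t = - r / 2 when r < 0; in the second case |r| <= 1 keeps the loss bounded. *)
Lemma sqr_1B_expR_half (r : R) : `|r| <= 1 ->
  r ^+ 2 / 16 <= (1 - expR (r / 2)) ^+ 2.
Proof.
move=> r1; rewrite (_ : r ^+ 2 / 16 = (`|r| / 4) ^+ 2); last first.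
  by rewrite exprMn real_normK ?num_real//; field.
rewrite -(@real_normK _ (1 - _)) ?num_real//.
rewrite ler_pXn2r ?nnegrE// ?divr_ge0//.
have [r0|r0] := leP 0 r.
  have := expR_ge1Dx (r / 2); rewrite (ger0_norm r0) => H.
  rewrite ler0_norm; lra.
have := expR_ge1Dx (- (r / 2)); rewrite expRN.
have e0 := expR_gt0 (r / 2); have : expR (r / 2) <= 1 by rewrite expR_le1; lra.
move: (expR _) e0 => e e0 e1 H.
rewrite (ltr0_norm r0) (ger0_norm (_ : 0 <= 1 - e)); last by lra.
move: r1; rewrite (ltr0_norm r0) => r1.
have K : e * (1 + - (r / 2)) <= 1.
  by rewrite -[leRHS](mulfV (lt0r_neq0 e0)) ler_pM2l.
nra.
Qed.

(** The four candidates are S + T, S - T, C + T and C - T with S, C the sine and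
cosine of w a and T the sine of w b. If all were below 1/2 in absolute value, then so
would be S and C, contradicting S^2 + C^2 = 1. *)
Lemma exists_shift_sin_sum_ge w a b : w != 0 ->
  exists e : bool * bool,
   2^-1 <= `|sin (w * (a + e.1%:R * (pi / (2 * w)))) +
             sin (w * (b + e.2%:R * (pi / w)))|.
Proof.
move=> w0.
have H0 (x y : R) : w * (x + false%:R * y) = w * x by rewrite mul0r addr0.
have Ha : w * (a + true%:R * (pi / (2 * w))) = w * a + pi / 2.
  by rewrite mulr1n mul1r; field.
have Hb : w * (b + true%:R * (pi / w)) = w * b + pi.
  by rewrite mulr1n mul1r; field.
have sc := cos2Dsin2 (w * a).
have [h1|h1] := lerP 2^-1 `|sin (w * a) + sin (w * b)|.
  by exists (false, false); rewrite /= !H0.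
have [h2|h2] := lerP 2^-1 `|sin (w * a) - sin (w * b)|.
  by exists (false, true); rewrite /= H0 Hb sinDpi.
have [h3|h3] := lerP 2^-1 `|cos (w * a) + sin (w * b)|.
  by exists (true, false); rewrite /= H0 Ha sinDpihalf.
have [h4|h4] := lerP 2^-1 `|cos (w * a) - sin (w * b)|.
  by exists (true, true); rewrite /= Ha Hb sinDpihalf sinDpi.
exfalso; move: h1 h2 h3 h4; rewrite !ltr_norml.
by move=> /andP[? ?] /andP[? ?] /andP[? ?] /andP[? ?]; nra.
Qed.

Definition coord_Z w : R := fine (\int[mu]_a (expR (- coord_potential w a))%:E)%E.

Definition coord_pdf w a : R := expR (- coord_potential w a) / coord_Z w.

Definition coord_proposal w h a b : R :=
  (2 * pi * (2 * h)) `^ (- 2^-1) *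
  expR (- ((b - (a - h * coord_drift w a)) ^+ 2 / (2 * (2 * h)))).

Definition coord_joint w h (p : R * R) : R :=
  coord_pdf w p.1 * coord_proposal w h p.1 p.2.

(** This is sqrt (2 pi), in the form in which the normal density provides it. *)
Definition gauss_mass : R := (@normal_peak R 1)^-1.

Lemma gauss_mass_gt0 : 0 < gauss_mass.
Proof. by rewrite invr_gt0 normal_peak_gt0. Qed.

Lemma integral_expR_half_sqr :
  (\int[mu]_a (expR (- (a ^+ 2 / 2)))%:E = gauss_mass%:E)%E.
Proof.
have := @integral_normal_pdf R 0 1.
have pk := @normal_peak_gt0 R 1 (oner_neq0 _).
rewrite normal_pdfE ?oner_neq0//.
under eq_integral do rewrite EFinM.
rewrite ge0_integralZl//=; first last.
- by rewrite lee_fin ltW.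
- by move=> a _; rewrite lee_fin normal_fun_ge0.
- by apply/measurable_EFinP; exact: measurable_normal_fun.
rewrite /normal_fun /=.
under eq_integral do rewrite subr0 expr1n mulNr.
move=> H; rewrite /gauss_mass -[RHS]mule1 -H muleA -EFinM mulVf ?mul1e//.
by rewrite gt_eqF.
Qed.

Lemma measurable_coord_potential w : measurable_fun [set: R] (coord_potential w).
Proof.
rewrite /coord_potential; apply: measurable_funB.
  by apply: measurable_funM => //; exact: measurable_funX.
apply: measurable_funM => //.
apply: measurableT_comp; last exact: measurable_funM.
exact: (continuous_measurable_fun (@continuous_cos R)).
Qed.

Lemma measurable_coord_drift w : measurable_fun [set: R] (coord_drift w).
Proof.
rewrite /coord_drift; apply: measurable_funD => //; apply: measurable_funM => //.
apply: measurableT_comp; last exact: measurable_funM.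
exact: (continuous_measurable_fun (@continuous_sin R)).
Qed.

Lemma measurable_expRN_potential w :
  measurable_fun [set: R] (fun a => expR (- coord_potential w a)).
Proof.
apply: measurableT_comp => //; apply: measurableT_comp => //.
exact: measurable_coord_potential.
Qed.

Lemma coord_Z_bounds w : 1 <= w ->
  [/\ (\int[mu]_a (expR (- coord_potential w a))%:E = (coord_Z w)%:E)%E,
      0 < coord_Z w & coord_Z w <= expR 2^-1 * gauss_mass].
Proof.
move=> w1; have nm := gauss_mass_gt0.
have mG : measurable_fun [set: R] (fun a => expR (- (a ^+ 2 / 2))).
  apply: measurableT_comp => //; apply: measurableT_comp => //.
  by apply: measurable_funM => //; exact: measurable_funX.
have IG (c : R) : (\int[mu]_a (expR c * expR (- (a ^+ 2 / 2)))%:E =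
    (expR c * gauss_mass)%:E)%E.
  under eq_integral do rewrite EFinM.
  rewrite ge0_integralZl//; do ?[exact/measurable_EFinP
    |by move=> *; rewrite lee_fin expR_ge0].
  by rewrite integral_expR_half_sqr.
set I := (\int[mu]_a _)%E.
have ub : (I <= (expR 2^-1 * gauss_mass)%:E)%E.
  rewrite -IG; apply: le_integral_nonneg => a _; rewrite lee_fin ?expR_ge0//.
  by rewrite -expRD ler_expR; have /andP[] := coord_potential_bounds w a w1; lra.
have lb : ((expR (- 2^-1) * gauss_mass)%:E <= I)%E.
  rewrite -IG; apply: le_integral_nonneg => a _; rewrite lee_fin.
    by rewrite mulr_ge0// expR_ge0.
  by rewrite -expRD ler_expR; have /andP[] := coord_potential_bounds w a w1; lra.
have If : I \is a fin_num.
  rewrite ge0_fin_numE ?(le_lt_trans ub) ?ltry//.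
  by apply: integral_ge0 => a _; rewrite lee_fin expR_ge0.
have E : I = (coord_Z w)%:E by rewrite /coord_Z fineK.
rewrite E !lee_fin in ub lb; split => //.
by apply: lt_le_trans lb; rewrite mulr_gt0// expR_gt0.
Qed.

Lemma coord_pdf_gt0 w a : 1 <= w -> 0 < coord_pdf w a.
Proof. by move=> /coord_Z_bounds[_ Z0 _]; rewrite divr_gt0// expR_gt0. Qed.

Lemma integral_coord_pdf w : 1 <= w -> (\int[mu]_a (coord_pdf w a)%:E = 1)%E.
Proof.
move=> w1; have [I Z0 _] := coord_Z_bounds w w1.
under eq_integral do rewrite EFinM.
rewrite ge0_integralZr//; last 2 first.
- by apply/measurable_EFinP; exact: measurable_expRN_potential.
- by rewrite lee_fin invr_ge0 ltW.
by rewrite I -EFinM divff// gt_eqF.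
Qed.

Lemma coord_proposal_gt0 w h a b : 0 < h -> 0 < coord_proposal w h a b.
Proof.
by move=> h0; rewrite mulr_gt0 ?expR_gt0// powR_gt0// !mulr_gt0 ?pi_gt0.
Qed.

(** The proposal is the normal density with standard deviation sqrt (2 h). *)
Lemma integral_coord_proposal w h a : 0 < h ->
  (\int[mu]_b (coord_proposal w h a b)%:E = 1)%E.
Proof.
move=> h0; set m := a - h * coord_drift w a.
rewrite -(@integral_normal_pdf R m (Num.sqrt (2 * h))).
have s0 : Num.sqrt (2 * h) != 0 by rewrite sqrtr_eq0 -ltNge mulr_gt0.
apply: eq_integral => b _; rewrite normal_pdfE// /coord_proposal.
rewrite /normal_peak /normal_fun sqr_sqrtr; last by rewrite mulr_ge0// ltW.
congr (_ * _)%:E; last by rewrite -/m mulNr mulr_natl.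
rewrite powRN powR12_sqrt; last by rewrite !mulr_ge0// ?pi_ge0// ltW.
by congr (Num.sqrt _)^-1; rewrite -mulr_natr; ring.
Qed.

Lemma coord_jointE w h a b : coord_joint w h (a, b) =
  (coord_Z w)^-1 * (2 * pi * (2 * h)) `^ (- 2^-1) * expR (coord_exponent w h a b).
Proof.
rewrite /coord_joint /coord_pdf /coord_proposal /coord_exponent /= expRD.
by ring.
Qed.

Lemma measurable_coord_joint w h : measurable_fun [set: R * R] (coord_joint w h).
Proof.
have mfst : measurable_fun [set: R * R] (@fst R R) by exact: measurable_fst.
have msnd : measurable_fun [set: R * R] (@snd R R) by exact: measurable_snd.
apply: measurable_funM.
  apply: measurable_funM => //.
  by apply: (measurableT_comp (measurable_expRN_potential w)).
apply: measurable_funM => //.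
apply: measurableT_comp => //; apply: measurableT_comp => //.
apply: measurable_funM => //; apply: measurable_funX.
apply: measurable_funB => //; apply: measurable_funB => //.
apply: measurable_funM => //.
by apply: (measurableT_comp (measurable_coord_drift w)).
Qed.

Lemma integral_coord_joint w h : 1 <= w -> 0 < h ->
  (\int[mu2]_p (coord_joint w h p)%:E = 1)%E.
Proof.
move=> w1 h0; rewrite ge0_integral_plane; first last.
- by apply/measurable_EFinP; exact: measurable_coord_joint.
- move=> p; rewrite lee_fin mulr_ge0//; first exact/ltW/coord_pdf_gt0.
  exact/ltW/coord_proposal_gt0.
rewrite -(integral_coord_pdf w w1); apply: eq_integral => a _.
rewrite /coord_joint /=; under eq_integral do rewrite EFinM.
rewrite ge0_integralZl//.
- by rewrite integral_coord_proposal// mule1.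
- apply/measurable_EFinP; apply: measurable_funM => //.
  apply: measurableT_comp => //; apply: measurableT_comp => //.
  apply: measurable_funM => //; apply: measurable_funX.
  exact: measurable_funB.
- by move=> b _; rewrite lee_fin; exact/ltW/coord_proposal_gt0.
- by rewrite lee_fin; exact/ltW/coord_pdf_gt0.
Qed.

Lemma coord_joint_gt0 w h p : 1 <= w -> 0 < h -> 0 < coord_joint w h p.
Proof.
by move=> w1 h0; rewrite mulr_gt0 ?coord_pdf_gt0 ?coord_proposal_gt0.
Qed.

Definition coord_overlap w h (p : R * R) : R :=
  Num.sqrt (coord_joint w h p * coord_joint w h (p.2, p.1)).

Lemma measurable_coord_overlap w h : measurable_fun [set: R * R] (coord_overlap w h).
Proof.
have mJ := measurable_coord_joint w h.
apply: measurableT_comp.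
  exact: (continuous_measurable_fun (@sqrt_continuous R)).
apply: measurable_funM => //.
by apply: (measurableT_comp mJ); exact: measurable_swap.
Qed.

Lemma coord_affinity_le1 w h : 1 <= w -> 0 < h ->
  (\int[mu2]_p (coord_overlap w h p)%:E <= 1)%E.
Proof.
move=> w1 h0; rewrite (_ : 1%E = (1 - 0 / 2)%:E); last by rewrite mul0r subr0.
apply: overlap_le_of_hellinger.
- by move=> p; exact/ltW/coord_joint_gt0.
- exact: measurable_coord_joint.
- exact: integral_coord_joint.
- by apply: integral_ge0 => p _; rewrite lee_fin sqr_ge0.
Qed.

(** The first factor bounds from below the inverse normalizing constant of the
target, the second one comes from the proposal, expR (- 7) from coord_exponent_ge,
and the denominator collects (16^2)(16) from the squared log-ratio, 4 from the four
shifts and 2 from the Hellinger identity. *)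
Definition affinity_gap : R :=
  (expR 2^-1 * gauss_mass)^-1 * (Num.sqrt (4 * pi))^-1 * expR (- 7) / (8 * 16 ^+ 3).

Lemma affinity_gap_gt0 : 0 < affinity_gap.
Proof.
rewrite /affinity_gap divr_gt0// !mulr_gt0 ?expR_gt0// invr_gt0.
  by rewrite mulr_gt0 ?expR_gt0// gauss_mass_gt0.
by rewrite sqrtr_gt0 mulr_gt0// pi_gt0.
Qed.

(** At a good shift of (a, b) the squared difference of square roots is
X (1 - exp (r / 2))^2 with X >= K exp (- 7) and |r| >= s / (16 w), which gives the
value k fed to integral_four_shifts. *)
Lemma coord_affinity_ub w s : 1 <= w -> 0 < s -> s <= 100^-1 ->
  100 <= w * s -> s ^+ 2 * w <= 200^-1 ->
  (\int[mu2]_p (coord_overlap w (s ^+ 2) p)%:E <=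
    (1 - affinity_gap * (s / w) ^+ 2)%:E)%E.
Proof.
move=> w1 s0 ss ws sw.
have w0 : 0 < w by lra.
have h0 : 0 < s ^+ 2 by rewrite exprn_gt0.
have [_ Z0 Zub] := coord_Z_bounds w w1.
set K := (coord_Z w)^-1 * (2 * pi * (2 * s ^+ 2)) `^ (- 2^-1).
have KE : K = (coord_Z w)^-1 * (Num.sqrt (4 * pi))^-1 / s.
  rewrite /K powRN powR12_sqrt; last by rewrite !mulr_ge0// ?pi_ge0// ltW.
  rewrite (_ : 2 * pi * (2 * s ^+ 2) = 4 * pi * s ^+ 2); last by ring.
  rewrite sqrtrM; last by rewrite mulr_ge0// pi_ge0.
  by rewrite sqrtr_sqr gtr0_norm// invfM mulrA.
have sp0 : 0 < Num.sqrt (4 * pi : R) by rewrite sqrtr_gt0 mulr_gt0// pi_gt0.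
have K0 : 0 < K by rewrite KE divr_gt0// mulr_gt0// invr_gt0.
have pi_le4 : (pi : R) <= 4 by have := @pihalf_lt2 R; lra.
have pi_pos := @pi_gt0 R.
have piw : pi / w <= s / 25.
  rewrite ler_pdivrMr// (_ : s / 25 * w = w * s / 25); last by ring.
  by rewrite ler_pdivlMr//; lra.
have piw0 : 0 <= pi / w by rewrite divr_ge0// ltW.
have pi2wE : pi / (2 * w) = pi / w / 2 by field; rewrite gt_eqF.
(* k is the size of the integrand at a good shift. *)
pose k := K * (expR (- 7) * ((s / w) ^+ 2 / 16 ^+ 3)).
have k0 : 0 <= k.
  apply: mulr_ge0; first exact: ltW.
  apply: mulr_ge0; first exact: expR_ge0.
  by apply: divr_ge0 => //; exact: sqr_ge0.
apply: (@le_trans _ _ (1 - (k * s / 4) / 2)%:E); last first.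
  pose c := (Num.sqrt (4 * pi))^-1 * expR (- 7) / (8 * 16 ^+ 3) * (s / w) ^+ 2.
  have c0 : 0 < c.
    apply: mulr_gt0; last by rewrite exprn_gt0// divr_gt0.
    apply: divr_gt0; last by rewrite mulr_gt0// exprn_gt0.
    by rewrite mulr_gt0 ?expR_gt0// invr_gt0.
  have -> : k * s / 4 / 2 = (coord_Z w)^-1 * c.
    by rewrite /k KE /c; field; rewrite !gt_eqF.
  have -> : affinity_gap * (s / w) ^+ 2 = (expR 2^-1 * gauss_mass)^-1 * c.
    by rewrite /affinity_gap /c !mulrA.
  rewrite lee_fin lerB// ler_pM2r// lef_pV2// posrE.
  by rewrite mulr_gt0 ?expR_gt0// gauss_mass_gt0.
apply: overlap_le_of_hellinger.
- by move=> p; exact/ltW/coord_joint_gt0.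
- exact: measurable_coord_joint.
- exact: integral_coord_joint.
apply: (integral_four_shifts _ _ _ (pi / (2 * w)) (pi / w)) => //.
- by move=> p; exact: sqr_ge0.
- have mJ := measurable_coord_joint w (s ^+ 2).
  have msqrt := continuous_measurable_fun (@sqrt_continuous R).
  apply: measurable_funX; apply: measurable_funB.
    exact: (measurableT_comp msqrt).
  apply: (measurableT_comp msqrt); apply: (measurableT_comp mJ).
  exact: measurable_swap.
move=> a b /andP[a0 a1] /andP[b1 b2].
have [e He] := exists_shift_sin_sum_ge w a b (lt0r_neq0 w0).
exists e.
set a' := a + _ in He *; set b' := b + _ in He *.
have e01 (x : bool) : ((0 : R) <= x%:R) && ((x%:R : R) <= 1).
  by case: x; rewrite ?lexx ?ler01.
have a'a : a <= a' <= a + s / 50.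
  have /andP[] := e01 e.1; rewrite /a' pi2wE.
  move: (_%:R) => x x0 x1; apply/andP; split; first by rewrite lerDl; nra.
  by rewrite lerD2l; nra.
have b'b : b <= b' <= b + s / 25.
  have /andP[] := e01 e.2; rewrite /b'.
  move: (_%:R) => x x0 x1; apply/andP; split; first by rewrite lerDl; nra.
  by rewrite lerD2l; nra.
have A0 : 0 <= a' by lra.
have A2 : a' <= 2 by lra.
have B1 : s <= b' - a' by lra.
have B2 : b' - a' <= 3 * s by lra.
have L := coord_exponent_ge w s a' b' w1 s0 ss A0 A2 B1 B2.
have /andP[r1 r2] := coord_log_ratio_bounds w s a' b' w1 s0 ss ws sw A0 A2 B1 B2 He.
rewrite /= !coord_jointE -/K.
set L1 := coord_exponent _ _ a' b' in L r1 r2 *.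
set L2 := coord_exponent _ _ b' a' in r1 r2 *.
have sqE (l : R) : Num.sqrt (K * expR l) = Num.sqrt K * expR (l / 2).
  rewrite sqrtrM; last exact: ltW.
  congr (_ * _); rewrite -[in LHS](@divfK _ 2 _ l)// mulrC expRM_natl.
  by rewrite sqrtr_sqr ger0_norm// expR_ge0.
rewrite !sqE -mulrBr exprMn sqr_sqrtr; last exact: ltW.
have -> : expR (L1 / 2) - expR (L2 / 2) =
    expR (L1 / 2) * (1 - expR ((L2 - L1) / 2)).
  by rewrite mulrBr mulr1 -expRD; congr (_ - expR _); field.
rewrite exprMn -expRM_natl (_ : 2%:R * (L1 / 2) = L1); last by field.
rewrite /k ler_pM2l//; apply: ler_pM => //.
- by rewrite divr_ge0// sqr_ge0.
- by rewrite ler_expR.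
apply: le_trans (sqr_1B_expR_half _ r2).
rewrite -[X in _ <= X / 16](@real_normK _ (L2 - L1)) ?num_real//.
rewrite ler_pdivlMr// (_ : _ * 16 = (s / (16 * w)) ^+ 2); last first.
  by field; rewrite gt_eqF.
by rewrite ler_pXn2r// nnegrE divr_ge0// ltW// mulr_gt0.
Qed.

Lemma is_derive_coord_potential (w a : R) : w != 0 ->
  is_derive a 1 (coord_potential w) (coord_drift w a).
Proof.
move=> w0; rewrite /coord_potential /coord_drift.
apply: is_derive_eq.
rewrite /GRing.scale/=; field.
by rewrite w0.
Qed.

Lemma continuous_coord_pdf (w : R) : w != 0 -> continuous (coord_pdf w).
Proof.
move=> w0 a; apply: cvgM; last exact: cvg_cst.
apply: (@continuous_comp _ _ _ (fun a => - coord_potential w a) expR);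
  last exact: continuous_expR.
apply: cvgN; apply/differentiable_continuous/derivable1_diffP.
by case: (is_derive_coord_potential w a w0).
Qed.

Lemma coord_pdfN (w a : R) : coord_pdf w (- a) = coord_pdf w a.
Proof. by rewrite /coord_pdf /coord_potential sqrrN mulrN cosN. Qed.

Lemma integral_coord_pdf_half (w : R) : 1 <= w ->
  (\int[mu]_(a in [set a | (0 <= a)%R]) (coord_pdf w a)%:E = 2^-1%:E)%E.
Proof.
move=> w1; have w0 : w != 0 by rewrite gt_eqF// (lt_le_trans _ w1).
have := ge0_symfun_integralT (fun a => ltW (coord_pdf_gt0 w a w1))
  (continuous_coord_pdf w w0) (fun a => esym (coord_pdfN w a)).
rewrite integral_coord_pdf// => /esym H.
by rewrite -[RHS]mule1 -H muleA -EFinM mulVf// mul1e.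
Qed.

End coordinate.

(** * Factorization over the coordinates *)

Section dimension.
Context {R : realType}.
Variables (n : nat) (eta : R).
Hypothesis w_ge1 : 1 <= n%:R `^ eta.
Local Notation w := (n%:R `^ eta).
Local Notation V := (cosine_potential n eta).
Local Notation leb := (lebesgue_rV R n).

Lemma cosine_potentialE (x : 'rV[R]_n) :
  V x = \sum_(i < n) coord_potential w (x ord0 i).
Proof.
rewrite /cosine_potential /coord_potential sumrB -mulr_suml; congr (_ - _).
rewrite -mulr_suml mulrC; congr (_ * (2 * _)^-1).
by rewrite mulrC powRrM powR_mulrn// powR_ge0.
Qed.

(** The potential is a sum of functions of one coordinate, so the difference
quotient along a basis vector is the difference quotient of one summand. *)
Lemma gradient_cosine_potential (x : 'rV[R]_n) :
  gradient V x = \row_i coord_drift w (x ord0 i).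
Proof.
have w0 : w != 0 by rewrite gt_eqF// (lt_le_trans _ w_ge1).
apply/rowP => i; rewrite !mxE.
have D := is_derive_coord_potential w (x ord0 i) w0.
rewrite -(@derive_val _ _ _ _ _ _ _ D) /derive.
set F := (fun h : R => h^-1 *: ((V \o shift x) (h *: delta_mx ord0 i) - V x)).
set G := (fun h : R => h^-1 *: ((coord_potential w \o shift (x ord0 i)) (h *: 1)
   - coord_potential w (x ord0 i))).
suff -> : F = G by [].
apply/funext => h; rewrite /F /G /=; congr (_ * _).
rewrite !cosine_potentialE (bigD1 i)//= [in X in _ - X](bigD1 i)//=.
rewrite !mxE !eqxx mulr1 [h *: 1]mulr1.
rewrite (eq_bigr (fun j => coord_potential w (x ord0 j))); last first.
  by move=> j ji; rewrite !mxE (negbTE ji) andbF mulr0 add0r.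
by rewrite opprD addrACA subrr addr0.
Qed.

Lemma expRN_cosine_potential (x : 'rV[R]_n) :
  expR (- V x) = \prod_(i < n) expR (- coord_potential w (x ord0 i)).
Proof. by rewrite cosine_potentialE -sumrN expR_sum. Qed.

Lemma gibbs_pdfE (x : 'rV[R]_n) :
  gibbs_pdf V x = \prod_(i < n) coord_pdf w (x ord0 i).
Proof.
have [I Z0 _] := coord_Z_bounds w w_ge1.
rewrite /gibbs_pdf.
under eq_integral do rewrite expRN_cosine_potential -prodEFin.
rewrite (integral_rV_prod n (fun _ a => (expR (- coord_potential w a))%:E)); first last.
- by move=> i; apply/measurable_EFinP; exact: measurable_expRN_potential.
- by move=> i a; rewrite lee_fin expR_ge0.
under [X in fine X]eq_bigr do rewrite I.
by rewrite prodEFin/= expRN_cosine_potential -prodfV -big_split.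
Qed.

Lemma mala_proposal_pdfE (h : R) (x y : 'rV[R]_n) : 0 < h ->
  mala_proposal_pdf V h x y =
  \prod_(i < n) coord_proposal w h (x ord0 i) (y ord0 i).
Proof.
move=> h0; rewrite /mala_proposal_pdf /isotropic_gaussian_pdf.
rewrite /coord_proposal big_split/= prodr_const card_ord; congr (_ * _).
  rewrite -powR_mulrn ?powR_ge0// -powRrM; congr (_ `^ _); lra.
rewrite -expR_sum sumrN; congr (expR (- _)).
rewrite /sqnorm mulr_suml; apply: eq_bigr => i _.
by rewrite gradient_cosine_potential !mxE.
Qed.

End dimension.

(** * From the conductance to the one-dimensional affinity *)

(** This is min (X, Y) <= sqrt (X Y) for X = p q and Y = p' q', divided by p. *)
Lemma metropolis_flow_le_geometric_mean (R : realType) (p q p' q' : R) :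
  0 < p -> 0 < q -> 0 < p' -> 0 < q' ->
  q * Num.min 1 ((p' * q') / (p * q)) <= p^-1 * Num.sqrt (p * q * (p' * q')).
Proof.
move=> p0 q0 p'0 q'0.
have X0 : 0 < p * q by rewrite mulr_gt0.
have Y0 : 0 < p' * q' by rewrite mulr_gt0.
rewrite [leRHS]mulrC ler_pdivlMr// -mulrAC [q * p]mulrC [leLHS]mulrC.
move: (p * q) (p' * q') X0 Y0 => X Y X0 Y0.
have XY0 : 0 <= X * Y by rewrite mulr_ge0// ltW.
have [XY|YX] := leP X Y.
  rewrite min_l; last by rewrite ler_pdivlMr// mul1r.
  rewrite mul1r -[leLHS](gtr0_norm X0) -sqrtr_sqr; apply: ler_wsqrtr.
  by rewrite expr2 ler_pM2l.
rewrite min_r; last by rewrite ler_pdivrMr// mul1r ltW.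
rewrite divfK ?gt_eqF// -[leLHS](gtr0_norm Y0) -sqrtr_sqr; apply: ler_wsqrtr.
by rewrite expr2 ler_pM2r// ltW.
Qed.

Lemma sqrtr_prod (R : rcfType) (I : Type) (s : seq I) (f : I -> R) :
  (forall i, 0 <= f i) ->
  Num.sqrt (\prod_(i <- s) f i) = \prod_(i <- s) Num.sqrt (f i).
Proof.
move=> f0; elim: s => [|i s IH]; first by rewrite !big_nil sqrtr1.
by rewrite !big_cons sqrtrM// IH.
Qed.

Section conductance_bound.
Context {R : realType}.
Local Notation mu := (@lebesgue_measure R).
Local Notation mu2 := (@lebesgue_measure R \x @lebesgue_measure R)%E.
Variables (n : nat) (eta h : R).
Hypothesis n_gt0 : (0 < n)%N.
Hypothesis w_ge1 : 1 <= n%:R `^ eta.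
Hypothesis h_gt0 : 0 < h.
Local Notation w := (n%:R `^ eta).
Local Notation V := (cosine_potential n eta).
Local Notation leb := (lebesgue_rV R n).

Let G (a : R) : \bar R := (\int[mu]_b (coord_overlap w h (a, b))%:E)%E.

Let G_ge0 a : (0 <= G a)%E.
Proof. by apply: integral_ge0 => b _; rewrite lee_fin sqrtr_ge0. Qed.

Let mG : measurable_fun [set: R] G.
Proof.
have mO : measurable_fun [set: R * R] (EFin \o coord_overlap w h).
  by apply/measurable_EFinP; exact: measurable_coord_overlap.
by apply: (@measurable_fun_fubini_tonelli_F _ _ _ _ _ mu _ mO) => p /=;
  rewrite lee_fin sqrtr_ge0.
Qed.

Let integral_G : (\int[mu]_a G a = \int[mu2]_p (coord_overlap w h p)%:E)%E.
Proof.
rewrite ge0_integral_plane//.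
  by move=> p; rewrite lee_fin sqrtr_ge0.
by apply/measurable_EFinP; exact: measurable_coord_overlap.
Qed.

Let gibbs_pdf_gt0 x : 0 < gibbs_pdf V x.
Proof.
by rewrite gibbs_pdfE// prodr_gt0// => i _; exact: coord_pdf_gt0.
Qed.

Let mala_proposal_pdf_gt0 x y : 0 < mala_proposal_pdf V h x y.
Proof.
by rewrite mala_proposal_pdfE// prodr_gt0// => i _; exact: coord_proposal_gt0.
Qed.

(** The atom of the kernel at x does not charge the complement of S, and the
acceptance flow is bounded by a product, whose integral factors. *)
Lemma mala_kernel_le (x : 'rV[R]_n) (S : set 'rV[R]_n) : S x ->
  (mala_kernel V h x (~` S) <=
   (gibbs_pdf V x)^-1%:E * \prod_(i < n) G (x ord0 i))%E.
Proof.
move=> Sx; rewrite /mala_kernel indicE memNset// mul0e adde0.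
pose ov (y : 'rV[R]_n) := \prod_(i < n) coord_overlap w h (x ord0 i, y ord0 i).
have ov0 y : 0 <= ov y by rewrite prodr_ge0// => i _; exact: sqrtr_ge0.
have mg i : measurable_fun [set: R]
    (fun b => (coord_overlap w h (x ord0 i, b))%:E).
  apply/measurable_EFinP.
  by apply: (measurableT_comp (measurable_coord_overlap w h)).
have -> : (\prod_(i < n) G (x ord0 i) = \int[leb]_y (ov y)%:E)%E.
  rewrite -(integral_rV_prod n (fun i b => (coord_overlap w h (x ord0 i, b))%:E))//.
    by apply: eq_integral => y _; rewrite prodEFin.
  by move=> i a; rewrite lee_fin sqrtr_ge0.
rewrite -ge0_integralZl//; first last.
- by rewrite lee_fin invr_ge0 ltW.
- by move=> y _; rewrite lee_fin.
- under eq_fun do rewrite /ov -prodEFin.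
  apply: emeasurable_prod => i.
  exact: (measurableT_comp (mg i) (measurable_coord _)).
rewrite [leLHS]integral_mkcond; apply: le_integral_nonneg => y _; rewrite patchE.
  case: ifP => // _; rewrite lee_fin mulr_ge0//; first exact: ltW.
  by rewrite le_min ler01 divr_ge0// mulr_ge0// ltW.
have RHS0 : (0 <= (gibbs_pdf V x)^-1%:E * (ov y)%:E)%E.
  by rewrite lee_fin mulr_ge0// invr_ge0 ltW.
case: ifP => // _; rewrite -EFinM lee_fin /mala_acceptance.
apply: le_trans (metropolis_flow_le_geometric_mean _ _ _ _ _ _ _ _ _) _ => //.
rewrite le_eqVlt; apply/orP; left; apply/eqP; congr (_ * _).
rewrite !gibbs_pdfE// !mala_proposal_pdfE// -!big_split/= sqrtr_prod//.
have J a b : 0 <= coord_joint w h (a, b) by exact/ltW/coord_joint_gt0.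
by move=> i; apply: mulr_ge0; [exact: (J (x ord0 i))|exact: (J (y ord0 i))].
Qed.

(** Averaging over the target cancels the factor 1 / p(x) of mala_kernel_le and
leaves the integral of a product of functions of one coordinate. *)
Lemma escape_le (S : set 'rV[R]_n) : measurable S ->
  (\int[gibbs V]_(x in S) mala_kernel V h x (~` S) <=
   \prod_(i < n) \int[mu2]_p (coord_overlap w h p)%:E)%E.
Proof.
move=> mS.
pose B (x : 'rV[R]_n) := ((gibbs_pdf V x)^-1%:E * \prod_(i < n) G (x ord0 i))%E.
have P0 (x : 'rV[R]_n) : (0 <= \prod_(i < n) G (x ord0 i))%E.
  by apply: prode_ge0 => i _.
have B0 x : (0 <= B x)%E by rewrite mule_ge0// lee_fin invr_ge0 ltW.
have mP : measurable_fun [set: 'rV[R]_n] (fun x => \prod_(i < n) G (x ord0 i))%E.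
  apply: emeasurable_prod => i.
  exact: (measurableT_comp mG (measurable_coord _)).
have mB : measurable_fun [set: 'rV[R]_n] B.
  apply: emeasurable_funM => //; apply/measurable_EFinP.
  under eq_fun do rewrite -powR_inv1 ?ltW//.
  apply: (measurableT_comp (measurable_powR _)).
  exact: measurable_gibbs_pdf.
apply: (@le_trans _ _ (\int[gibbs V]_x B x)%E).
  rewrite [leLHS]integral_mkcond; apply: le_integral_nonneg => x _; rewrite patchE.
    case: ifP => // xS; rewrite /mala_kernel indicE memNset; last first.
      by apply; exact: set_mem.
    rewrite mul0e adde0; apply: integral_ge0 => y _.
    rewrite lee_fin mulr_ge0//; first exact: ltW.
    by rewrite le_min ler01 divr_ge0// mulr_ge0// ltW.
  case: ifP => // xS; apply: mala_kernel_le; exact: set_mem.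
rewrite (ge0_integral_density _ _ _ leb _ (gibbs_pdf V))//; first last.
- exact: measurable_gibbs_pdf.
- by move=> x; exact: ltW.
rewrite -integral_G.
have -> : (\int[leb]_x (B x * (gibbs_pdf V x)%:E) =
    \int[leb]_x \prod_(i < n) G (x ord0 i))%E.
  apply: eq_integral => x _; rewrite /B muleAC -EFinM mulVf ?mul1e//.
  by rewrite gt_eqF.
by rewrite (integral_rV_prod n (fun=> G)).
Qed.

Let i0 : 'I_n := Ordinal n_gt0.

Let half_space : set 'rV[R]_n := [set x | 0 <= x ord0 i0].

Let measurable_half_space : measurable half_space.
Proof.
have -> : half_space = (fun x : 'rV[R]_n => x ord0 i0) @^-1` `[0, +oo[%classic.
  by apply/seteqP; split => x /=; rewrite /half_space /= in_itv/= andbT.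
by rewrite -[X in measurable X]setTI; exact: measurable_coord.
Qed.

Let gibbs_half_space : gibbs V half_space = 2^-1%:E.
Proof.
have mp : measurable_fun [set: R] (EFin \o coord_pdf w).
  apply/measurable_EFinP; apply: measurable_funM => //.
  exact: measurable_expRN_potential.
have mI : measurable [set a : R | 0 <= a] by rewrite -set_itvcy.
pose g (i : 'I_n) : R -> \bar R := if i == i0
  then (EFin \o coord_pdf w) \_ [set a : R | 0 <= a] else EFin \o coord_pdf w.
have g0 i a : (0 <= g i a)%E.
  have p0 : (0 <= (coord_pdf w a)%:E)%E by rewrite lee_fin; exact/ltW/coord_pdf_gt0.
  by rewrite /g; case: ifP => // _; rewrite patchE; case: ifP.
have mg i : measurable_fun [set: R] (g i).
  rewrite /g; case: ifP => // _.
  by apply/(measurable_restrictT _ _).1 => //; exact: measurable_funTS.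
have gibbsE : gibbs V half_space =
    (\int[leb]_x \prod_(i < n) g i (x ord0 i))%E.
  rewrite /gibbs [LHS]integral_mkcond; apply: eq_integral => x _.
  rewrite patchE (bigD1 i0)//= [g i0]/g eqxx patchE gibbs_pdfE//.
  have -> : (x \in half_space) = (x ord0 i0 \in [set a : R | 0 <= a]).
    by apply/idP/idP => /set_mem ?; exact/mem_set.
  case: ifP => _; last by rewrite mul0e.
  rewrite -prodEFin (bigD1 i0)//=; congr (_ * _)%E.
  by apply: eq_bigr => i /negbTE ii0; rewrite /g ii0.
rewrite gibbsE integral_rV_prod// (bigD1 i0)//= big1 ?mule1.
  rewrite /g eqxx -integral_mkcond; exact: integral_coord_pdf_half.
by move=> i /negbTE ii0; rewrite /g ii0; exact: integral_coord_pdf.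
Qed.

(** The factor 2 is the inverse of the mass of the half-space. *)
Lemma conductance_le_affinity (r : R) :
  (\int[mu2]_p (coord_overlap w h p)%:E <= r%:E)%E ->
  (conductance (gibbs V) (mala_kernel V h) <= (2 * r ^+ n)%:E)%E.
Proof.
move=> Ir; apply: (@le_trans _ _ ((\int[gibbs V]_(x in half_space)
    mala_kernel V h x (~` half_space)) / gibbs V half_space)%E).
  apply: ereal_inf_lbound; exists half_space => //; split => //.
  suff : (0 < gibbs V half_space <= 2^-1%:E)%E by [].
  by rewrite gibbs_half_space lexx lte_fin invr_gt0 ltr0n.
rewrite gibbs_half_space inver invr_eq0 pnatr_eq0 /= invrK muleC EFinM.
rewrite lee_wpmul2l//; apply: le_trans (escape_le _ measurable_half_space) _.
have I0 : (0 <= \int[mu2]_p (coord_overlap w h p)%:E)%E.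
  by apply: integral_ge0 => p _; rewrite lee_fin sqrtr_ge0.
move: Ir I0; case: (\int[mu2]_p _)%E => // I Ir I0.
rewrite prodEFin lee_fin prodr_const card_ord.
by rewrite !lee_fin in Ir I0; apply: lerXn2r => //; rewrite nnegrE// (le_trans I0).
Qed.

End conductance_bound.

(** * Asymptotics in the dimension *)

Lemma ge_root_powR (R : realType) (K x p : R) : 0 <= K -> 0 < p ->
  K `^ p^-1 <= x -> K <= x `^ p.
Proof.
move=> K0 p0 Kx; rewrite -[leLHS](powRr1 K0) -(mulVf (lt0r_neq0 p0)) powRrM.
apply: ge0_ler_powR; rewrite ?nnegrE ?powR_ge0//; first exact: ltW.
by apply: le_trans Kx; exact: powR_ge0.
Qed.

(** The three lower bounds on x give w s >= 100, s^2 w <= 1/200 and s <= 1/100, in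
this order, where s = sqrt h: indeed (w s)^2 >= x^delta,
s^2 w <= x^(- 1/12) and s^2 <= x^(- 1/3). The last inequality holds with 5 delta in
place of 4 delta. *)
Lemma coord_affinity_le_expR (R : realType) (delta x h : R) :
  0 < delta -> delta < 18^-1 -> 1 <= x ->
  (100 ^+ 2) `^ delta^-1 <= x -> 200 `^ 12 <= x -> (100 ^+ 2) `^ 3 <= x ->
  x `^ (- 2^-1 + 3 * delta) <= h -> h <= x `^ (- 3^-1) ->
  let w := x `^ (4^-1 - delta) in
  (\int[@lebesgue_measure R \x @lebesgue_measure R]_p (coord_overlap w h p)%:E <=
   (expR (- (affinity_gap * (h / w ^+ 2))))%:E)%E /\
  x `^ (4 * delta) <= x * (h / w ^+ 2).
Proof.
move=> d0 d18 x1 xM1 xM2 xM3 h1 h2 w.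
have x0 : 0 < x by lra.
have xn0 : x != 0 by rewrite gt_eqF.
have pD (r t : R) : x `^ r * x `^ t = x `^ (r + t).
  by rewrite powRD// xn0 implybT.
have h0 : 0 < h by apply: lt_le_trans h1; rewrite powR_gt0.
have w1 : 1 <= w by rewrite -(powRr0 x) ler_powR//; lra.
have w0 : 0 < w by lra.
pose s := Num.sqrt h.
have s0 : 0 < s by rewrite sqrtr_gt0.
have sE : s ^+ 2 = h by rewrite sqr_sqrtr// ltW.
have w2E : w ^+ 2 = x `^ (2 * (4^-1 - delta)).
  by rewrite -powR_mulrn ?powR_ge0// -powRrM mulrC.
have ss : s <= 100^-1.
  rewrite -(@ler_pXn2r _ 2) ?nnegrE// ?(ltW s0) ?invr_ge0// sE.
  apply: le_trans h2 _; rewrite powRN exprVn lef_pV2 ?posrE ?powR_gt0 ?exprn_gt0//.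
  by apply: ge_root_powR; rewrite ?invr_gt0 ?exprn_ge0// invrK.
have sw : s ^+ 2 * w <= 200^-1.
  rewrite sE; apply: (@le_trans _ _ (x `^ (- 3^-1) * w)).
    by rewrite ler_pM2r.
  rewrite /w pD; apply: (@le_trans _ _ (x `^ (- 12^-1))).
    by rewrite ler_powR//; lra.
  rewrite powRN lef_pV2 ?posrE ?powR_gt0//.
  by apply: ge_root_powR; rewrite ?invr_gt0// invrK.
have ws : 100 <= w * s.
  rewrite -(@ler_pXn2r _ 2) ?nnegrE ?mulr_ge0// ?(ltW s0) ?(ltW w0)//.
  rewrite exprMn sE w2E.
  apply: (@le_trans _ _ (x `^ (2 * (4^-1 - delta)) * x `^ (- 2^-1 + 3 * delta)));
    last by rewrite ler_pM2l// powR_gt0.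
  rewrite pD (_ : 2 * _ + _ = delta); last by field.
  by apply: ge_root_powR; rewrite ?exprn_ge0.
split.
  have := coord_affinity_ub w s w1 s0 ss ws sw.
  rewrite sE exprMn sE exprVn => /le_trans; apply.
  rewrite lee_fin; apply: le_trans (expR_ge1Dx _); exact: lexx.
apply: (@le_trans _ _ (x * (x `^ (- 2^-1 + 3 * delta) / w ^+ 2))); last first.
  by rewrite ler_pM2l// ler_pM2r// invr_gt0 exprn_gt0.
rewrite w2E -powRN pD -{2}[x](powRr1 (ltW x0)) pD ler_powR//; lra.
Qed.

Theorem theorem8 (R : realType) (delta : R) (delta_gt0 : 0 < delta)
    (delta_lt : delta < 18^-1) :
  exists C0 c0 : R, [/\ 0 < C0, 0 < c0 &
    forall (d : nat) (h : R), (1 <= d)%N ->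
      d%:R `^ (- 2^-1 + 3 * delta) <= h -> h <= d%:R `^ (- 3^-1) ->
      (conductance (gibbs (cosine_potential d (4^-1 - delta)))
                   (mala_kernel (cosine_potential d (4^-1 - delta)) h) <=
         (C0 * expR (- (c0 * d%:R `^ (4 * delta))))%:E)%E].
Proof.
pose M : R := (100 ^+ 2) `^ delta^-1 + 200 `^ 12 + (100 ^+ 2) `^ 3.
have c0 := @affinity_gap_gt0 R; set c := affinity_gap in c0.
exists (2 * expR (c * M `^ (4 * delta))), c; split=> //.
  by rewrite mulr_gt0// expR_gt0.
move=> d h d1 h1 h2; set x : R := d%:R in h1 h2 *.
have x1 : 1 <= x by rewrite ler1n.
have h0 : 0 < h by apply: lt_le_trans h1; rewrite powR_gt0//; lra.
have w1 : 1 <= x `^ (4^-1 - delta).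
  by rewrite -[leLHS](powRr0 x) ler_powR//; lra.
have M0 : 0 <= M by rewrite !addr_ge0 ?powR_ge0.
(* Below the threshold M the trivial affinity bound 1 is used: the factor
     expR (c * M `^ (4 * delta)) of C0 compensates the exponential. *)
have [Mx|xM] := leP M x; last first.
  have := conductance_le_affinity d _ h d1 w1 h0 1 (coord_affinity_le1 _ _ w1 h0).
  move=> /le_trans; apply; rewrite lee_fin expr1n -mulrA ler_pM2l// -expRD.
  rewrite -[leLHS]expR0 ler_expR -mulrBr; apply: mulr_ge0; first exact: ltW.
  by rewrite subr_ge0 ge0_ler_powR ?nnegrE//; lra.
have p1 : 0 <= (100 ^+ 2 : R) `^ delta^-1 by exact: powR_ge0.
have p2 : 0 <= (200 : R) `^ 12 by exact: powR_ge0.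
have p3 : 0 <= (100 ^+ 2 : R) `^ 3 by exact: powR_ge0.
have [|||I G] := coord_affinity_le_expR _ delta x h delta_gt0 delta_lt x1 _ _ _ h1 h2.
- by apply: le_trans Mx; rewrite /M -addrA lerDl addr_ge0.
- by apply: le_trans Mx; rewrite /M addrAC lerDr addr_ge0.
- by apply: le_trans Mx; rewrite /M lerDr addr_ge0.
have := conductance_le_affinity d _ h d1 w1 h0 _ I.
move=> /le_trans; apply; rewrite lee_fin -mulrA ler_pM2l// -expRD -expRM_natl.
rewrite ler_expR -/c -/x mulrN.
set g := h / _ in G *.
have cM : 0 <= c * M `^ (4 * delta) by rewrite mulr_ge0 ?powR_ge0// ltW.
have : c * x `^ (4 * delta) <= c * (x * g) by rewrite ler_pM2l.
rewrite mulrCA; lra.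
Qed.
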